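(* Let $n$ be a positive integer and let $S=S_1\cup S_2\subseteq T_{8n}\setminus\{e\}$ be nonempty with $S=S^{-1}$, where $S_1\subseteq\langle a\rangle\cup\langle a\rangle b^2$ and $S_2\subseteq\langle a\rangle b\cup\langle a\rangle b^3$, and suppose that $\mathrm{Cay}(T_{8n},S)$ is normal, i.e. $S$ is a union of conjugacy classes of $T_{8n}$. Then the normal Cayley graph $\mathrm{Cay}(T_{8n},S)$ is integral if and only if $S_1$ and $S_2$ satisfy the following conditions: (1) $S_1$ is one of the following sets: $\emptyset$, $[a^r]$, $[a^rb^2]$, or arbitrary finite unions of these sets, where $$[a^r]=\{a^l\in\langle a^r\rangle \mid \gcd(k,o(a^r))=1 \text{ and } l\equiv kr \pmod{2n},\ k\in\mathbb N^+\},$$ $$[a^rb^2]=\{a^lb^2\in\langle a^rb^2\rangle \mid \mathrm{lcm}(o(a^r),4)=\mathrm{lcm}(o(a^l),4),\ l\equiv r(4t+1)\pmod{2n} \text{ or } l\equiv r(4t+3)+n\pmod{2n},\ t\in\mathbb N^+\},$$ $o(a^r)=\frac{2n}{\gcd(r,2n)}$ denotes the order of the element $a^r$, and $o(a^rb^2)=\mathrm{lcm}(o(a^r),4)$; (2) $S_2$ is one of the following sets: - $\emptyset$ or $\{a^rb,a^rb^3\mid r=0,1,\dots,2n-1\}$, if $n$ is odd; - $\emptyset$, $\{a^rb,a^rb^3\mid r=0,2,\dots,2n-2\}$, $\{a^rb,a^rb^3\mid r=1,3,\dots,2n-1\}$, or $\{a^rb,a^rb^3\mid r=0,1,\dots,2n-1\}$,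 if $n$ is even.
   Context: $T_{8n}=\langle a,b\mid a^{2n}=b^8=e,\ a^n=b^4,\ b^{-1}ab=a^{-1}\rangle$ is a group of order $8n$ with identity $e$; its elements are $a^r b^s$ with $0\le r\le 2n-1$, $0\le s\le 3$ (each written uniquely in this form). $o(x)$ denotes the order of an element $x$ of $T_{8n}$. For a finite group $G$ with identity $e$ and a nonempty $S\subseteq G\setminus\{e\}$ with $S=S^{-1}$, $\mathrm{Cay}(G,S)$ is the graph with vertex set $G$ in which $x,y$ are adjacent iff $xy^{-1}\in S$. It is called normal if $S$ is a union of conjugacy classes of $G$. A graph is integral if all eigenvalues of its adjacency matrix are integers. $\mathbb N^+$ is the set of positive integers. In the set descriptions in (1), the conditions on $l$ are to hold for some $k$ (respectively $t$) in $\mathbb N^+$.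
   Formalization: The side remark o(a^r b^2) = lcm(o(a^r),4) is left out because it is false in general (n = 2, r = 1: ab^2 has order 2, not 4); it is not used in the sets [a^r], [a^r b^2], and the equivalence is kept in full. *)

(* Defs.v *)
From HB Require Import structures.
From mathcomp Require Import all_boot all_order all_algebra all_fingroup.
From mathcomp Require Import all_solvable all_field.
From mathcomp Require Import boolp.

Set Implicit Arguments.
Unset Strict Implicit.
Unset Printing Implicit Defensive.

Import GRing.Theory Num.Theory.

Local Open Scope ring_scope.

Definition adjmx (T : finType) (e : rel T) : 'M[algC]_#|T| :=
  \matrix_(i, j) (e (enum_val i) (enum_val j))%:R.

(* The entries of [adjmx e] are integers, so every complex eigenvalue is
   algebraic: quantifying over [algC] covers the whole spectrum. *)
Definition integral_graph (T : finType) (e : rel T) : Prop :=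
  forall z : algC, eigenvalue (adjmx e) z -> z \is a Num.int.

Local Close Scope ring_scope.
Local Open Scope group_scope.

Definition Cay (gT : finGroupType) (S : {set gT}) : rel gT :=
  [rel x y | x * y^-1 \in S].

Definition normal_Cay (gT : finGroupType) (S : {set gT}) : Prop :=
  exists2 C : {set {set gT}}, C \subset classes [set: gT] & S = cover C.

(* The first conjunct says that gT is the group defined by the presentation
   (which is a finite group), up to isomorphism; the others say that a and b
   are generators of gT satisfying the defining relations. *)
Definition is_T8n (gT : finGroupType) (n : nat) (a b : gT) : Prop :=
  [/\ [set: gT] \isog Grp (x : y :
        (x ^+ (2 * n), y ^+ 8, x ^+ n = y ^+ 4, y^-1 * x * y = x^-1)),
      <<[set a; b]>> = [set: gT],
      a ^+ (2 * n) = 1 /\ b ^+ 8 = 1,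
      a ^+ n = b ^+ 4
    & b^-1 * a * b = a^-1].

Section Blocks.

Variables (gT : finGroupType) (n : nat) (a b : gT).

Definition bracket_a (r : nat) : {set gT} :=
  [set x in <[a ^+ r]> | `[< exists l k : nat,
     [/\ x = a ^+ l, 0 < k, gcdn k #[a ^+ r] = 1%N
       & l = k * r %[mod 2 * n]] >] ].

Definition bracket_ab2 (r : nat) : {set gT} :=
  [set x in <[a ^+ r * b ^+ 2]> | `[< exists l t : nat,
     [/\ x = a ^+ l * b ^+ 2, 0 < t,
         lcmn #[a ^+ r] 4 = lcmn #[a ^+ l] 4
       & l = r * (4 * t + 1) %[mod 2 * n] \/
         l = r * (4 * t + 3) + n %[mod 2 * n]] >] ].

Definition odd_part (P : pred nat) : {set gT} :=
  [set a ^+ r * b | r : 'I_(2 * n) & P r] :|: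
  [set a ^+ r * b ^+ 3 | r : 'I_(2 * n) & P r].

(* Empty index sets R and Q give the empty set. *)
Definition S1_condition (S1 : {set gT}) : Prop :=
  exists R Q : {set 'I_(2 * n)},
    S1 = (\bigcup_(r in R) bracket_a r) :|: (\bigcup_(r in Q) bracket_ab2 r).

Definition S2_condition (S2 : {set gT}) : Prop :=
  if odd n then S2 = set0 \/ S2 = odd_part predT
  else [\/ S2 = set0, S2 = odd_part (fun r => ~~ odd r), S2 = odd_part odd
         | S2 = odd_part predT].

End Blocks.

(* Main.v *)
(* A class-invariant S acts on each irreducible module as the scalar
   chi(S) / chi(1) (Schur), and these scalars are the spectrum of Cay(G, S).
   They are algebraic integers in a cyclotomic field, on which the Galois group
   acts by chi(s) |-> chi(s ^ k), k prime to |G|. So the graph is integral iff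
   S is closed under these powers, i.e. x \in S implies y \in S whenever x and
   y generate the same cyclic group.
   In T_8n, [a^r] and [a^r b^2] are exactly the sets of generators of <a^r> and
   <a^r b^2>; on the other hand (a^r b)^2 = b^2, so for odd m the m-th power of
   a^r b is a^r b^m, with b^5 = a^n b, while a^r b is conjugate to a^(r+2) b:
   only the parity of r matters, and not even that if n is odd. *)

Require Import Defs.
From mathcomp Require Import all_boot all_order all_algebra all_fingroup.
From mathcomp Require Import all_solvable all_field all_character.
From mathcomp Require Import zify.
From mathcomp Require boolp.

Set Implicit Arguments.
Unset Strict Implicit.
Unset Printing Implicit Defensive.

Import GRing.Theory Num.Theory.

Local Open Scope group_scope.

(** * Integral normal Cayley graphs *)

Section NormalCayley.

Variable gT : finGroupType.
Implicit Types (S : {set gT}) (x y : gT).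

Local Open Scope ring_scope.

Local Notation G := [set: gT]%G.

Lemma normal_Cay_memJ S x y : normal_Cay S -> ((x ^ y)%g \in S) = (x \in S).
Proof.
case=> C /subsetP sC ->; have cl u v : u \in cover C -> (u ^ v)%g \in cover C.
  case/bigcupP=> K CK Ku; apply/bigcupP; exists K => //.
  have /imsetP[w _ eK] := sC _ CK; move: Ku; rewrite eK => /imsetP[h _ ->].
  by rewrite -conjgM memJ_class ?inE.
by apply/idP/idP => [/(cl _ y^-1%g)|]; rewrite ?conjgK //; apply: cl.
Qed.

(** * Spectrum of a normal Cayley graph *)

Definition Cay_eigen S (i : Iirr G) : algC :=
  (\sum_(s in S) 'chi_i s) / 'chi_i 1%g.

(** By Schur's lemma the sum of [rG s] over [S] is a scalar [c]; taking traces against [rG u] gives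
    the identity, and [u = 1] evaluates [c]. *)
Lemma sum_irr_mull S (i : Iirr G) y : normal_Cay S ->
  \sum_(s in S) 'chi_i (s * y)%g = Cay_eigen S i * 'chi_i y.
Proof.
move=> nS; pose rG := 'Chi_i; pose M := \sum_(s in S) rG s.
have chiE x : 'chi_i x = \tr (rG x) by rewrite -irrRepr cfunE inE mulr1n.
have /is_scalar_mxP[c Mc] : is_scalar_mx M.
  have absG : mx_absolutely_irreducible rG by apply: groupC; apply: socle_irr.
  apply: (mx_abs_irr_cent_scalar absG).
  apply/centgmxP => x Gx; rewrite /M mulmx_suml mulmx_sumr.
  rewrite [RHS](reindex_inj (conjg_inj x)) /=.
  apply: eq_big => [s | s _]; first by rewrite normal_Cay_memJ.
  by rewrite -!repr_mxM ?inE // conjgE mulKVg.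
have trM u : \sum_(s in S) 'chi_i (s * u)%g = c * 'chi_i u.
  rewrite chiE -mxtraceZ -mul_scalar_mx -Mc mulmx_suml raddf_sum.
  by apply: eq_bigr => s _; rewrite chiE repr_mxM ?inE.
rewrite trM; congr (_ * _); apply: (mulIf (irr1_neq0 i)).
by rewrite divfK ?irr1_neq0 // -trM; apply: eq_bigr => s _; rewrite mulg1.
Qed.

(** The irreducible characters are themselves eigenvectors. Conversely, an eigenfunction has a
    nonzero component in some isotypic part, where the adjacency operator is the scalar
    [Cay_eigen S i]. *)
Lemma eigenvalue_CayP S z : normal_Cay S ->
  eigenvalue (adjmx (Cay S)) z <-> exists i, z = Cay_eigen S i.
Proof.
move=> nS.
have adjE (f : gT -> algC) j :
    ((\row_k f (enum_val k)) *m adjmx (Cay S)) 0 j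
      = \sum_(s in S) f (s * enum_val j)%g.
  rewrite mxE [RHS]big_mkcond (reindex_inj (mulIg (enum_val j)^-1%g)) /=.
  rewrite [RHS](reindex (@enum_val _ gT)) /=; last first.
    by apply: onW_bij; apply: enum_val_bij.
  apply: eq_bigr => k _; rewrite !mxE mulgKV /Cay /=.
  by case: ifP; rewrite ?mulr1 ?mulr0.
split=> [/eigenvalueP[v vA v0] | [i ->]]; last first.
  apply/eigenvalueP; exists (\row_k 'chi_i (enum_val k)).
    by apply/rowP=> j; rewrite adjE sum_irr_mull // !mxE.
  apply/eqP=> /rowP/(_ (enum_rank 1%g)); rewrite !mxE enum_rankK.
  exact/eqP/irr1_neq0.
pose f x := v 0 (enum_rank x).
have vE : v = \row_k f (enum_val k) by apply/rowP=> k; rewrite mxE /f enum_valK.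
have fS y : \sum_(s in S) f (s * y)%g = z * f y.
  rewrite -[y]enum_rankK -adjE -vE vA mxE {1}/f !enum_rankK //.
(* F i is, up to a scalar, the projection of f on the chi_i-isotypic part. *)
pose F i y := \sum_g 'chi[G]_i g^-1%g * f (g * y)%g.
have zF i y : z * F i y = Cay_eigen S i * F i y.
  rewrite /F !mulr_sumr.
  transitivity (\sum_g \sum_(s in S) 'chi_i g^-1%g * f (s * g * y)%g).
    apply: eq_bigr => g _; rewrite mulrCA -fS mulr_sumr.
    by apply: eq_bigr => s _; rewrite mulgA.
  rewrite exchange_big /=.
  transitivity (\sum_(s in S) \sum_g 'chi_i (g^-1 * s)%g * f (g * y)%g).
    apply: eq_bigr => s _; rewrite (reindex_inj (mulgI s^-1%g)) /=.
    by apply: eq_bigr => g _; rewrite invMg invgK mulKVg.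
  rewrite exchange_big /=; apply: eq_bigr => g _.
  rewrite mulrA -sum_irr_mull // mulr_suml; apply: eq_bigr => s _.
  congr (_ * _); rewrite -[RHS](cfunJ _ (s * g^-1)%g (in_setT s)).
  by rewrite conjgE mulgA mulKg.
have /existsP[i /existsP[y Fiy]] : [exists i, exists y, F i y != 0].
  apply: contraNT v0 => /existsPn F0; apply/eqP/rowP=> j; rewrite !mxE.
  have {}F0 i y : F i y = 0.
    by have /existsPn/(_ y)/negbNE/eqP := F0 i.
  (* Weighting by ['chi_i 1] assembles the regular character, which is |G| at 1 and 0 elsewhere, so
     the sum recovers [v]. *)
  have: \sum_i 'chi[G]_i 1%g * F i (enum_val j) = #|G|%:R * v 0 j.
    transitivity (\sum_g cfReg G g^-1%g * f (g * enum_val j)%g).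
      rewrite cfReg_sum; under eq_bigr do rewrite mulr_sumr.
      rewrite exchange_big; apply: eq_bigr => g _ /=.
      rewrite sum_cfunE mulr_suml; apply: eq_bigr => i _.
      by rewrite cfunE mulrA.
    rewrite (bigD1 1%g) //= big1 => [|g g1].
      by rewrite invg1 cfRegE eqxx mul1g addr0 /f enum_valK.
    by rewrite cfRegE invg_eq1 (negPf g1) mul0r.
  under eq_bigr do rewrite F0 mulr0.
  rewrite big1 // => /esym/eqP; rewrite mulf_eq0 (negPf (neq0CG _)).
  by move/eqP.
by exists i; apply: (mulIf Fiy).
Qed.

(** * Galois action on character values *)

(** One exponent serves all [N]-th roots of unity, since they are powers of a single primitive
    root. *)
Lemma aut_unity_root (nu : {rmorphism algC -> algC}) N : (0 < N)%N ->
  exists2 k, coprime k N & forall z : algC, z ^+ N = 1 -> nu z = z ^+ k.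
Proof.
move=> N_gt0; have [w prim_w] := C_prim_root_exists N_gt0.
have : N.-primitive_root (nu w) by rewrite fmorph_primitive_root.
have /(prim_rootP prim_w)[k nuw] : nu w ^+ N = 1.
  by rewrite -rmorphXn (prim_expr_order prim_w) rmorph1.
rewrite nuw prim_root_exp_coprime // => co_k; exists k => // z zN.
by have [j ->] := prim_rootP prim_w zN; rewrite rmorphXn /= nuw -!exprM mulnC.
Qed.

(** On [<[x]>] the character is a sum of linear characters with natural multiplicities, which [nu]
    fixes, and their values are [N]-th roots of unity. *)
Lemma char_aut_exp (nu : {rmorphism algC -> algC}) N k (chi : 'CF(G)) x :
    chi \is a character -> (#[x]%g %| N)%N ->
    (forall z : algC, z ^+ N = 1 -> nu z = z ^+ k) ->
  nu (chi x) = chi (x ^+ k)%g.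
Proof.
move=> chiN dv_x nuE; have xx : x \in <[x]>%g := cycle_id x.
have sxG : <[x]>%g \subset G by apply: subsetT.
have ResE m : chi (x ^+ m)%g = 'Res[<[x]>%g] chi (x ^+ m)%g.
  by rewrite cfResE ?mem_cycle.
rewrite -{1}[x]expg1 !ResE expg1 (cfun_sum_cfdot ('Res chi)).
rewrite !sum_cfunE raddf_sum; apply: eq_bigr => i _ /=; rewrite !cfunE rmorphM.
rewrite aut_natr ?Cnat_cfdot_char_irr ?cfRes_char //; congr (_ * _).
have lin_i : 'chi_i \is a linear_char by apply/char_abelianP/cycle_abelian.
rewrite lin_charX // nuE //; have /dvdnP[q ->] := dv_x.
by rewrite mulnC exprM lin_char_unity_root // expr1n.
Qed.

Lemma Cay_eigen_aut (nu : {rmorphism algC -> algC}) k S (i : Iirr G) :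
    (forall z : algC, z ^+ #|gT| = 1 -> nu z = z ^+ k) ->
  nu (Cay_eigen S i) = (\sum_(s in S) 'chi_i (s ^+ k)%g) / 'chi_i 1%g.
Proof.
move=> nuE.
have nu_chi x : nu ('chi_i x) = 'chi_i (x ^+ k)%g.
  apply: (char_aut_exp (irr_char i)) nuE.
  by rewrite -cardsT order_dvdG ?inE.
rewrite fmorph_div /= nu_chi expg1n rmorph_sum /=.
by congr (_ / _); apply: eq_bigr => s _; apply: nu_chi.
Qed.

(** [S] is a disjoint union of classes K, so the eigenvalue is a sum of central character values |K|
    chi(x) / chi(1), which are algebraic integers. *)
Lemma Aint_Cay_eigen S i : normal_Cay S -> Cay_eigen S i \in Aint.
Proof.
case=> C sCG ->; rewrite /Cay_eigen big_trivIset /=; last first.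
  by apply: trivIsetS sCG _; have /and3P[] := classes_partition G.
rewrite mulr_suml rpred_sum // => K /(subsetP sCG)/imsetP[x Gx ->].
rewrite (eq_bigr (fun=> 'chi_i x)); last first.
  by move=> _ /imsetP[g Gg ->]; apply: cfunJ.
by rewrite sumr_const -[_ *+ _]mulr_natl Aint_class_div_irr1.
Qed.

(** All character values lie in a Galois extension [Qn] of the rationals whose automorphisms extend
    to [algC], so invariance puts the eigenvalue in the fixed field. *)
Lemma Cay_eigen_rat S (i : Iirr G) :
    (forall nu : {rmorphism algC -> algC},
       nu (Cay_eigen S i) = Cay_eigen S i) ->
  Cay_eigen S i \in Crat.
Proof.
have [Qn galQn [QnC gQnC [w _ Qn_chi]]] := group_num_field_exists G.
have chi_Qn x : {a | QnC a = 'chi_i x}.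
  by apply: Qn_chi; rewrite ?irr_char ?order_dvdG ?inE.
pose q := (\sum_(s in S) sval (chi_Qn s)) / sval (chi_Qn 1%g).
have Dq : QnC q = Cay_eigen S i.
  rewrite fmorph_div rmorph_sum /= (svalP (chi_Qn 1%g)).
  by congr (_ / _); apply: eq_bigr => s _; apply: (svalP (chi_Qn s)).
rewrite -Dq => fix_q.
suffices /vlineP[c ->] : q \in 1%VS.
  by have /= -> := fmorph_eq_rat (QnC \o in_alg Qn) c; apply: Crat_rat.
have /galois_fixedField <- := galQn.
apply/fixedFieldP; rewrite ?memvf // => nuQ Gal_nuQ.
by apply: (fmorph_inj QnC); have [nu ->] := gQnC nuQ; apply: fix_q.
Qed.

Theorem integral_normal_CayP S : normal_Cay S ->
  integral_graph (Cay S) <->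
  forall k x, coprime k #|gT| -> x \in S -> (x ^+ k)%g \in S.
Proof.
move=> nS; split=> [intS k x co_k Sx | clS z].
  have [nu nuE] := Qn_aut_exists co_k.
  have sum_k i : \sum_(s in S) 'chi[G]_i (s ^+ k)%g = \sum_(s in S) 'chi_i s.
    apply: (mulIf (invr_neq0 (irr1_neq0 i))); rewrite -(Cay_eigen_aut _ _ nuE).
    apply: aut_intr; apply: intS; apply/eigenvalue_CayP => //.
    by exists i.
  (* This is |C_G(y)| times the indicator of the class of [x ^+ k]. Column orthogonality expands it
     in irreducible characters, so [sum_k] equates its sums over [s] and over [s ^+ k], for s in
     [S]. *)
  pose c y : algC := #|'C_G[y]%g|%:R *+ (y \in (x ^+ k) ^: G)%g.
  have sum_c (h : gT -> gT) : \sum_(s in S) c (h s) =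
      \sum_i (\sum_(s in S) 'chi[G]_i (h s)) * ('chi_i (x ^+ k)%g)^*.
    under [RHS]eq_bigr do rewrite mulr_suml.
    rewrite exchange_big; apply: eq_bigr => s _.
    by rewrite /c -second_orthogonality_relation ?inE.
  have c_ge0 y : 0 <= c y by rewrite mulrn_wge0 ?ler0n.
  (* In the sum over [s ^+ k] the term of [x] is positive; hence [S] meets the class of [x ^+ k],
     and contains it by normality. *)
  have : 0 < \sum_(s in S) c s.
    rewrite (sum_c id); under eq_bigr do rewrite -sum_k.
    rewrite -(sum_c (fun s => s ^+ k)%g) (bigD1 x) //=.
    rewrite ltr_wpDr ?sumr_ge0 // /c class_refl.
    by rewrite ltr0n cardG_gt0.
  rewrite lt0r sumr_ge0 // andbT; apply: contraNT => notSxk.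
  rewrite big1 // => s Ss; rewrite /c; case: imsetP => // -[g _ ds].
  by rewrite -(normal_Cay_memJ _ g nS) -ds Ss in notSxk.
case/(eigenvalue_CayP _ nS) => i ->; apply: Cint_rat_Aint; last first.
  exact: Aint_Cay_eigen.
apply: Cay_eigen_rat => nu.
have [k co_k nuE] : exists2 k, coprime k #|gT| &
    forall z : algC, z ^+ #|gT| = 1 -> nu z = z ^+ k.
  by apply: aut_unity_root; rewrite -cardsT cardG_gt0.
rewrite (Cay_eigen_aut _ _ nuE) /Cay_eigen; congr (_ / _).
(* The [k]-th power map is injective, hence permutes [S], which makes the eigenvalue invariant. *)
have co_kG : coprime #|G| k by rewrite coprime_sym cardsT.
have injk : {in G &, injective (fun x => x ^+ k)%g}.
  exact/can_in_inj/(expgK co_kG).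
have imS : [set x ^+ k | x in S]%g = S.
  apply/eqP; rewrite eqEcard card_in_imset ?leqnn ?andbT => [|x y *].
    by apply/subsetP=> _ /imsetP[x Sx ->]; apply: clS.
  by apply: injk; rewrite ?inE.
by rewrite -[in RHS]imS big_imset //= => x y *; apply: injk; rewrite ?inE.
Qed.

(** * From power maps to generators of cyclic subgroups *)

(** Chinese remainders: take k congruent to [m] modulo [d] and to 1 modulo the part of [N] prime to
    [d]. *)
Lemma coprime_lift N d m : (0 < N)%N -> (d %| N)%N -> coprime d m ->
  exists2 k, coprime k N & k = m %[mod d].
Proof.
move=> N_gt0 dvdN co_dm; have d_gt0 := dvdn_gt0 N_gt0 dvdN.
pose q := (N`_(\pi(d)^')%N)%N; have co_dq : coprime d q.
  by rewrite coprime_pi' // ?part_gt0 ?part_pnat.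
exists (chinese d q m 1); last exact: chinese_modl.
rewrite -(partnC \pi(d) N_gt0) coprimeMr; apply/andP; split; last first.
  by rewrite -coprime_modl chinese_modr // coprime_modl coprime1n.
have : coprime d (chinese d q m 1).
  by rewrite -coprime_modr chinese_modl // coprime_modr.
(* [coprime_pi'] needs a positive argument; a zero solution forces [d = 1]. *)
have [-> | k_gt0] := posnP (chinese d q m 1).
  rewrite /coprime gcdn0 => /eqP ->.
  by rewrite part_p'nat // -coprime_pi' // coprime1n.
by rewrite coprime_pi' // coprime_sym; apply/pnat_coprime/part_pnat.
Qed.

Corollary integral_normal_Cay_cycleP S : normal_Cay S ->
  integral_graph (Cay S) <->
  forall x y, <[x]>%g = <[y]>%g -> x \in S -> y \in S.
Proof.
move=> nS; rewrite integral_normal_CayP //.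
have dvG x : (#[x]%g %| #|gT|)%N by rewrite -cardsT order_dvdG ?inE.
split=> [clS x y exy Sx | clS k x co_k].
  have : generator <[x]> y by rewrite /generator exy.
  have /cycleP[m ->] : y \in <[x]>%g by rewrite exy cycle_id.
  rewrite generator_coprime => /(coprime_lift _ (dvG x))[|k co_k kmod].
    by rewrite -cardsT cardG_gt0.
  have /eqP <- : (x ^+ k == x ^+ m)%g by rewrite eq_expg_mod_order kmod.
  exact: clS.
apply: clS; apply/eqP; rewrite -[_ == _]/(generator _ _) generator_coprime.
by rewrite coprime_sym (coprime_dvdr (dvG x)).
Qed.

End NormalCayley.

(** * The group T_8n *)

(* Right multiplications by a and b on T_8n, where (r, s) stands for a^r b^s:
   they generate a group with at least 8n elements satisfying the relations. *)
Section Model.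

Variable n : nat.
Hypothesis n_gt0 : 0 < n.

Local Notation point := ('Z_(2 * n) * 'Z_4)%type.

(** Moving a to the left past b^s inverts it when s is odd. *)
Definition model_a_fun (u : point) : point :=
  ((if odd u.2 then u.1 - 1 else u.1 + 1)%R, u.2).

(** When the exponent of b passes 3, b^4 = a^n is carried to the first coordinate. *)
Definition model_b_fun (u : point) : point :=
  ((if u.2 == 3%R then u.1 + n%:R else u.1)%R, (u.2 + 1)%R).

Lemma model_a_inj : injective model_a_fun.
Proof.
move=> [r s] [r' s'] e; have /= es := congr1 snd e; have /= := congr1 fst e.
by rewrite es; case: ifP => _ /addIr ->.
Qed.

Lemma model_b_inj : injective model_b_fun.
Proof.
move=> [r s] [r' s'] e; have /= /addIr es := congr1 snd e.
by have /= := congr1 fst e; rewrite es; case: ifP => _ => [/addIr|] ->.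
Qed.

Definition model_a := perm model_a_inj.
Definition model_b := perm model_b_inj.

Lemma model_aX k (u : point) :
  (model_a ^+ k) u = ((if odd u.2 then u.1 - k%:R else u.1 + k%:R)%R, u.2).
Proof.
elim: k => [|k IHk].
  by case: u => r s; rewrite perm1 /= subr0 addr0 if_same.
rewrite expgSr permM IHk permE /model_a_fun /=; case: (odd u.2).
  by rewrite -addrA -opprD natr1.
by rewrite -addrA natr1.
Qed.

Lemma model_bX k r : k < 4 -> (model_b ^+ k) (r, 0)%R = (r, k%:R)%R.
Proof.
elim: k => [|k IHk] k4; first by rewrite perm1.
rewrite expgSr permM IHk 1?ltnW // permE /model_b_fun /= natr1.
by case: k k4 {IHk} => [|[|[|]]].
Qed.

Lemma mod2n_natr : ((2 * n)%:R = 0 :> 'Z_(2 * n))%R.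
Proof. by rewrite pchar_Zp //; lia. Qed.

Lemma model_b4 (u : point) : (model_b ^+ 4) u = (u.1 + n%:R, u.2)%R.
Proof.
case: u => r s; rewrite !expgS expg0 mulg1 !permM !permE /model_b_fun /=.
have: s \in [:: 0; 1; 2%:R; 3%:R]%R by case: s => [[|[|[|[|]]]]].
by rewrite !inE => /or4P[] /eqP -> /=; congr (_, _); apply/eqP.
Qed.

Lemma opp_natr_n : (- n%:R = n%:R :> 'Z_(2 * n))%R.
Proof.
apply/eqP; rewrite -subr_eq0 -opprD oppr_eq0 -natrD addnn -mul2n.
by rewrite mod2n_natr.
Qed.

Lemma model_rel :
  [/\ model_a ^+ (2 * n) = 1, model_b ^+ 8 = 1, model_a ^+ n = model_b ^+ 4
    & model_b^-1 * model_a * model_b = model_a^-1].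
Proof.
have an : model_a ^+ n = model_b ^+ 4.
  by apply/permP => u; rewrite model_aX model_b4 opp_natr_n if_same.
have a2n : model_a ^+ (2 * n) = 1.
  apply/permP => -[r s]; rewrite model_aX perm1 mod2n_natr.
  by rewrite subr0 addr0 if_same.
split=> //; first by rewrite (expgM _ 4 2) -an -expgM (mulnC n 2).
(* The relation is checked in the inverse-free form b = a b a. *)
apply: (mulIg model_a); rewrite mulVg -!mulgA; apply/eqP.
rewrite -eq_invg_mul invgK; apply/eqP/permP => -[r s].
rewrite !permM !permE /model_a_fun /model_b_fun /=.
have: s \in [:: 0; 1; 2%:R; 3%:R]%R by case: s => [[|[|[|[|]]]]].
rewrite !inE => /or4P[] /eqP -> /=; congr (_, _);
  by rewrite ?addrK ?subrK // addrAC subrK.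
Qed.

(** The presentation maps onto the model group, in which the products a^r b^s are told apart by
    their action on one point. *)
Lemma leq_card_T8n (gT : finGroupType) (a b : gT) :
  is_T8n n a b -> 8 * n <= #|gT|.
Proof.
case=> isoG _ _ _ _; pose H := <<[set model_a; model_b]>>%G.
have : H \homg [set: gT].
  rewrite isoG; apply/existsP; exists (model_a, model_b).
  have [a2n b8 an ab] := model_rel.
  by rewrite /= joing_idl joing_idr a2n b8 an ab !eqxx.
rewrite -cardsT => /leq_homg; apply: leq_trans.
pose f (u : point) := model_a ^+ u.1 * model_b ^+ u.2.
have f_inj : injective f.
  (* The permutation [f (r, s)] sends (0, 0) to (r, s). *)
  move=> [r s] [r' s'] /(congr1 (fun p : {perm point} => p (0, 0)%R)).
  rewrite !permM !model_aX /= !add0r !natr_Zp.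
  by rewrite !model_bX ?ltn_ord // !natr_Zp.
apply: (@leq_trans #|[set f u | u : point]|).
  rewrite (card_imset _ f_inj) card_prod !card_ord !Zp_cast //; last by lia.
  by lia.
apply/subset_leq_card/subsetP=> _ /imsetP[u _ ->].
by rewrite groupM ?groupX ?mem_gen ?inE ?eqxx ?orbT.
Qed.

End Model.

Section T8nTheory.

Variables (gT : finGroupType) (n : nat) (a b : gT).
Hypotheses (n_gt0 : 0 < n) (T8n : is_T8n n a b).

(** * Normal form and powers *)

Lemma T8n_a2n : a ^+ (2 * n) = 1.
Proof. by case: T8n => _ _ []. Qed.

Lemma T8n_aX r : a ^+ (r %% (2 * n)) = a ^+ r.
Proof. exact/expg_mod/T8n_a2n. Qed.

Lemma T8n_b8 : b ^+ 8 = 1.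
Proof. by case: T8n => _ _ []. Qed.

Lemma T8n_b4 : b ^+ 4 = a ^+ n.
Proof. by case: T8n. Qed.

Lemma T8n_conj : a ^ b = a^-1.
Proof. by case: T8n => _ _ _ _; rewrite conjgE mulgA. Qed.

Lemma T8n_bX_modn s : b ^+ s = a ^+ (n * (s %/ 4)) * b ^+ (s %% 4).
Proof. by rewrite {1}(divn_eq s 4) expgD mulnC expgM T8n_b4 -expgM. Qed.

Lemma T8n_bX_mul x s : x \in <[a]> ->
  b ^+ s * x = (if odd s then x^-1 else x) * b ^+ s.
Proof.
elim: s x => [|s IHs] x Ax; first by rewrite mul1g mulg1.
have -> : b ^+ s.+1 * x = b ^+ s * x^-1 * b.
  rewrite expgSr -!mulgA; congr (_ * _); rewrite [RHS]conjgC; congr (_ * _).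
  by have /cycleP[r ->] := Ax; rewrite conjVg conjXg T8n_conj expgVn invgK.
by rewrite IHs ?groupV //= invgK if_neg -mulgA -expgSr.
Qed.

Lemma T8n_normal_form g :
  exists r s, [/\ r < 2 * n, s < 4 & g = a ^+ r * b ^+ s].
Proof.
have nab : <[b]> \subset 'N(<[a]>).
  by rewrite cycle_subG; apply/normP; rewrite -cycleJ T8n_conj cycleV.
have : g \in <[a]> <*> <[b]>.
  by case: T8n => _ gen_ab _ _ _; rewrite joing_idl joing_idr joingE gen_ab inE.
rewrite norm_joinEr // => /mulsgP[_ _ /cycleP[i ->] /cycleP[s ->] ->].
exists ((i + n * (s %/ 4)) %% (2 * n)), (s %% 4); split; rewrite ?ltn_mod //.
  by rewrite muln_gt0.
by rewrite [b ^+ s]T8n_bX_modn mulgA -expgD T8n_aX.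
Qed.

(** There are 8n normal forms covering at least 8n elements, so the covering map is injective. *)
Lemma T8n_normal_form_inj r s r' s' :
    a ^+ r * b ^+ s = a ^+ r' * b ^+ s' -> s < 4 -> s' < 4 ->
  s = s' /\ r = r' %[mod 2 * n].
Proof.
have n2_gt0 : 0 < 2 * n by rewrite muln_gt0.
pose f (u : 'I_(2 * n) * 'I_4) := a ^+ u.1 * b ^+ u.2.
have f_inj : injective f.
  suffices /imset_injP inj_f : #|f @: setT| == #|[set: 'I_(2 * n) * 'I_4]|.
    by move=> u v; apply: inj_f; rewrite inE.
  rewrite eqn_leq leq_imset_card /= cardsT card_prod !card_ord.
  have -> : f @: setT = [set: gT].
    apply/setP=> g; rewrite inE; have [i [j [lti ltj ->]]] := T8n_normal_form g.
    by apply/imsetP; exists (Ordinal lti, Ordinal ltj).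
  by rewrite cardsT mulnAC; apply: leq_trans (leq_card_T8n n_gt0 T8n) _.
move=> e lts lts'; have ltm i : i %% (2 * n) < 2 * n by rewrite ltn_mod.
have := f_inj (Ordinal (ltm r), Ordinal lts) (Ordinal (ltm r'), Ordinal lts').
by rewrite /f /= !T8n_aX => /(_ e) [].
Qed.

Lemma order_T8n_a : #[a] = (2 * n)%N.
Proof.
apply/eqP; rewrite eqn_dvd order_dvdn T8n_a2n eqxx /=.
have /T8n_normal_form_inj[] // : a ^+ #[a] * b ^+ 0 = a ^+ 0 * b ^+ 0.
  by rewrite expg_order.
by move=> _; rewrite mod0n => /eqP.
Qed.

(** As b^4 lies in [<[a]>], the exponent of b matters only modulo 4; this invariant separates the
    cosets of [<[a]>]. *)
Lemma T8n_mod4 r s r' s' :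
  a ^+ r * b ^+ s = a ^+ r' * b ^+ s' -> s = s' %[mod 4].
Proof.
rewrite [b ^+ s]T8n_bX_modn [b ^+ s']T8n_bX_modn !mulgA -!expgD =>
  /T8n_normal_form_inj.
by rewrite !ltn_mod => /(_ isT isT)[].
Qed.

Lemma T8n_ab2_comm r : commute (a ^+ r) (b ^+ 2).
Proof. by apply/esym; rewrite T8n_bX_mul ?mem_cycle. Qed.

Lemma T8n_ab2X r m : (a ^+ r * b ^+ 2) ^+ m = a ^+ (r * m) * b ^+ (2 * m).
Proof. by rewrite expgMn ?expgM //; apply: T8n_ab2_comm. Qed.

(** For m congruent to 3 modulo 4 one gets b^6 = a^n b^2: hence the two congruences in
    [bracket_ab2]. *)
Lemma T8n_ab2X_odd r m : odd m ->
  (a ^+ r * b ^+ 2) ^+ m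
    = a ^+ (if m %% 4 == 1 then r * m else r * m + n)%N * b ^+ 2.
Proof.
move=> m1; rewrite T8n_ab2X.
have -> : (2 * m = 8 * (m %/ 4) + 2 * (m %% 4))%N by lia.
rewrite expgD expgM T8n_b8 expg1n mul1g.
have [-> //|m4] : m %% 4 = 1%N \/ m %% 4 = 3 by lia.
by rewrite m4 (expgD b 4 2) T8n_b4 mulgA -expgD.
Qed.

(** * The blocks as sets of generators *)

Lemma bracket_aE r : bracket_a n a r = [set x | <[x]> == <[a ^+ r]>].
Proof.
apply/setP=> x; rewrite !inE; apply/andP/eqP=> [[_ /boolp.asboolP] | e].
  case=> l [k [-> k_gt0 co_k]] e.
  have -> : a ^+ l = a ^+ r ^+ k by rewrite -T8n_aX e T8n_aX mulnC expgM.
  by apply/esym/eqP; rewrite [_ == _]generator_coprime /coprime gcdnC co_k.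
have Ax : x \in <[a ^+ r]> by rewrite -e cycle_id.
split=> //; apply/boolp.asboolP; have /cycleP[m dx] := Ax.
(* Adding the order makes the exponent positive without changing the power. *)
exists (r * m)%N, (m + #[a ^+ r]); split; first by rewrite expgM.
- by rewrite addn_gt0 order_gt0 orbT.
- apply/eqP; rewrite gcdnC gcdnDr -[_ == _]/(coprime _ _) -generator_coprime.
  by rewrite /generator -dx e.
apply/eqP; rewrite -order_T8n_a -eq_expg_mod_order [X in _ == a ^+ X]mulnC.
by rewrite !expgM expgD expg_order mulg1.
Qed.

(* The order of a^r b^2 itself need not be lcm(o(a^r), 4): for n = 2 the
   element a b^2 is an involution. *)
Lemma lcm_order_ab2 r : lcmn #[a ^+ r * b ^+ 2] 4 = lcmn #[a ^+ r] 4.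
Proof.
(* If 4 divides [m] then b^(2m) = 1, so only the factor a^r counts. *)
have dvE m : 4 %| m -> (#[a ^+ r * b ^+ 2] %| m) = (#[a ^+ r] %| m).
  case/dvdnP=> q ->; rewrite !order_dvdn T8n_ab2X -expgM.
  rewrite (_ : (2 * _ = 8 * q)%N); last by lia.
  by rewrite (expgM b) T8n_b8 expg1n mulg1.
apply/eqP; rewrite eqn_dvd !dvdn_lcm !dvdn_lcmr !andbT.
by apply/andP; split; [rewrite dvE | rewrite -dvE];
  rewrite ?dvdn_lcml ?dvdn_lcmr.
Qed.

Lemma T8n_abX_exists r s m :
  exists i, (a ^+ r * b ^+ s) ^+ m = a ^+ i * b ^+ (s * m).
Proof.
elim: m => [|m [i IHm]]; first by exists 0; rewrite muln0 mulg1.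
have /cycleP[j aj] :
    a ^+ i * (if odd (s * m) then a ^- r else a ^+ r) \in <[a]>.
  by rewrite groupM ?mem_cycle //; case: ifP; rewrite ?groupV mem_cycle.
exists j; rewrite expgSr IHm -mulgA [b ^+ _ * _]mulgA T8n_bX_mul ?mem_cycle //.
by rewrite !mulgA aj -mulgA -expgD mulnS addnC.
Qed.

(** A power of a^r' b^s' has b-exponent a multiple of s' modulo 4, odd only if s' is odd. This lets
    [S1] and [S2] be treated separately. *)
Lemma T8n_cycle_parity r s r' s' :
  <[a ^+ r * b ^+ s]> = <[a ^+ r' * b ^+ s']> -> odd s = odd s'.
Proof.
suffices impl i j i' j' :
    a ^+ i * b ^+ j \in <[a ^+ i' * b ^+ j']> -> odd j -> odd j'.
  move=> e; apply/idP/idP.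
    by apply: (impl r _ r'); rewrite -e cycle_id.
  by apply: (impl r' _ r); rewrite e cycle_id.
case/cycleP=> m; have [k ->] := T8n_abX_exists i' j' m; move/T8n_mod4 => e j1.
have : odd (j' * m) by lia.
by rewrite oddM => /andP[].
Qed.

(** The order o satisfies 4 | s o; since 4 does not divide [s], o is even. *)
Lemma T8n_coprime_order_odd r s m : ~~ (4 %| s) ->
  coprime #[a ^+ r * b ^+ s] m -> odd m.
Proof.
move=> s4; apply: contraLR => m0.
have [i] := T8n_abX_exists r s #[a ^+ r * b ^+ s]; rewrite expg_order => e.
have /T8n_mod4 : a ^+ 0 * b ^+ 0 = a ^+ i * b ^+ (s * #[a ^+ r * b ^+ s]).
  by rewrite -e mulg1.
set o := #[_] in e * => so.
have o2 : 2 %| o.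
  rewrite dvdn2; apply: contraNN s4 => o1.
  rewrite -(@Gauss_dvdl _ _ o); first by rewrite /dvdn -so.
  by apply: (@coprimeXl 2 2); rewrite coprime2n.
by apply/negP=> /eqP co; have := dvdn_gcd 2 o m; rewrite co o2 (dvdn2 m) m0.
Qed.

(** The congruences say that [x] is an odd power of [y]; the lcm condition then makes the exponent
    prime to the order of [y]. *)
Lemma bracket_ab2E r :
  bracket_ab2 n a b r = [set x | <[x]> == <[a ^+ r * b ^+ 2]>].
Proof.
set y := a ^+ r * b ^+ 2.
have expE l m : odd m ->
    l = (if m %% 4 == 1 then r * m else r * m + n)%N %[mod 2 * n] ->
  a ^+ l * b ^+ 2 = y ^+ m.
  by move=> m1 el; rewrite T8n_ab2X_odd // -T8n_aX el T8n_aX.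
apply/setP=> x; rewrite !inE; apply/andP/eqP=> [[_ /boolp.asboolP] | e].
  case=> l [t [dx _ eo el]].
  have [m m1 dxm] : exists2 m, odd m & x = y ^+ m.
    case: el => el.
      exists (4 * t + 1)%N; first by lia.
      by rewrite dx; apply: expE; rewrite ?el; [lia | rewrite ifT //; lia].
    exists (4 * t + 3); first by lia.
    by rewrite dx; apply: expE; rewrite ?el; [lia | rewrite ifF //; lia].
  apply/esym/eqP; rewrite dxm [_ == _]generator_coprime.
  have : #[y] %| lcmn #[x] 4.
    by rewrite dx lcm_order_ab2 -eo -lcm_order_ab2 dvdn_lcml.
  (* An odd g with lcm(o(y), 4) = lcm(o(y) / g, 4) divides 4, so it is 1. *)
  rewrite dxm orderXgcd; set g := gcdn _ _.
  have g_gt0 : 0 < g by rewrite gcdn_gt0 order_gt0.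
  have dv_g : g %| #[y] := dvdn_gcdl _ _.
  have dv : lcmn (#[y] %/ g) 4 %| (#[y] %/ g) * 4.
    by rewrite dvdn_lcm dvdn_mulr ?dvdn_mull.
  move=> /dvdn_trans/(_ dv); rewrite -{1}(divnK dv_g) dvdn_pmul2l; last first.
    by rewrite divn_gt0 // dvdn_leq.
  have : odd g by apply: dvdn_odd (dvdn_gcdr _ _) m1.
  rewrite /coprime -/g; case: g {g_gt0 dv_g dv} => [|[|[|[|[|g]]]]] //=.
have xy : x \in <[y]> by rewrite -e cycle_id.
split=> //; apply/boolp.asboolP; have /cycleP[m0 dx] := xy.
(* The shift keeps the power and ensures [4 <= m], so that t = [m %/ 4] is positive. *)
pose m := (m0 + 4 * #[y])%N.
have {}dx : x = y ^+ m by rewrite expgD mulnC expgM expg_order expg1n mulg1.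
have co_m : coprime #[y] m by rewrite -generator_coprime /generator -dx e.
have m1 : odd m by apply: T8n_coprime_order_odd co_m.
have m4 : 4 <= m by have := order_gt0 y; lia.
have eo l : x = a ^+ l * b ^+ 2 -> lcmn #[a ^+ r] 4 = lcmn #[a ^+ l] 4.
  by move=> dl; rewrite -!lcm_order_ab2 -dl /order e.
exists (if m %% 4 == 1 then r * m else r * m + n)%N, (m %/ 4).
have xl := T8n_ab2X_odd r m1; rewrite -/y -dx in xl; split=> //.
- by rewrite divn_gt0.
- exact: eo.
have [m41 | m43] : m %% 4 = 1%N \/ m %% 4 = 3 by lia.
  by left; rewrite m41 /=; congr (r * _ %% _); lia.
by right; rewrite m43 /=; congr ((r * _ + n) %% _); lia.
Qed.

(** * The odd cosets of [<[a]>] *)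

Lemma T8n_abX_odd r s m : odd s -> odd m ->
  (a ^+ r * b ^+ s) ^+ m = a ^+ r * b ^+ (s * m).
Proof.
move=> s1 m1; set x := _ * _; have x2 : x ^+ 2 = b ^+ (s * 2).
  rewrite expgS expg1 /x -mulgA [b ^+ s * _]mulgA T8n_bX_mul ?mem_cycle // s1.
  by rewrite -mulgA mulKVg -expgD muln2 addnn.
rewrite -(odd_double_half m) m1 expgD expg1 -mul2n expgM x2 -expgM.
rewrite -mulgA -expgD.
by congr (_ * b ^+ _); lia.
Qed.

(** Reducing b^s to exponent 1 or 3 shifts r by a multiple of [n], which can change its parity when
    [n] is odd; hence the condition on [Q]. *)
Lemma mem_odd_part (Q : pred bool) r s :
    (odd n -> Q true = Q false) -> odd s ->
  (a ^+ r * b ^+ s \in odd_part n a b (Q \o odd)) = Q (odd r).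
Proof.
move=> Qn s1; rewrite [b ^+ s]T8n_bX_modn mulgA -expgD.
have -> : Q (odd r) = Q (odd (r + n * (s %/ 4))).
  rewrite oddD oddM.
  by case: (odd n) Qn => [/(_ isT)|_]; case: (odd r); case: (odd _).
move: (r + _)%N => i; rewrite -T8n_aX -(@odd_mod i (2 * n)) ?oddM //.
have lt4 : s %% 4 < 4 by rewrite ltn_mod.
have : i %% (2 * n) < 2 * n by rewrite ltn_mod muln_gt0.
move: (i %% _) => {}i ltin; apply/setUP/idP=> [|Qi].
  case=> /imsetP[j]; rewrite !inE /= => Qj.
    rewrite -[X in _ = _ * X]expg1 => /T8n_normal_form_inj[] //.
    by move=> _; rewrite !modn_small // => ->.
  by case/T8n_normal_form_inj=> // _; rewrite !modn_small // => ->.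
have [-> | ->] : s %% 4 = 1%N \/ s %% 4 = 3 by lia.
  by left; apply/imsetP; exists (Ordinal ltin); rewrite ?inE.
by right; apply/imsetP; exists (Ordinal ltin); rewrite ?inE.
Qed.

Lemma odd_partP (P : pred nat) x : x \in odd_part n a b P ->
  exists r s, odd s /\ x = a ^+ r * b ^+ s.
Proof.
by case/setUP=> /imsetP[r _ ->]; [exists r, 1%N | exists r, 3].
Qed.

(** Treats both parities of [n] uniformly: the listed index sets are those defined by a predicate on
    the parity of r, constant if [n] is odd. *)
Lemma S2_conditionP S2 : S2_condition n a b S2 <->
  exists2 Q : pred bool, odd n -> Q true = Q false
                       & S2 = odd_part n a b (Q \o odd).
Proof.
have part0 : odd_part n a b (pred0 \o odd) = set0.
  apply/setP=> x; rewrite !inE; apply/norP.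
  by split; apply/imsetP=> -[r]; rewrite inE.
have eq_part P1 P2 : P1 =1 P2 -> odd_part n a b P1 = odd_part n a b P2.
  by move=> eP; congr (_ :|: _); apply/setP=> x; apply/imsetP/imsetP=> -[r];
    by rewrite inE => Pr ->; exists r; rewrite // inE ?eP // -eP.
rewrite /S2_condition; case: ifP => n1; split.
- by case=> ->; [exists pred0 | exists predT].
- case=> Q /(_ isT) Qn ->.
  case Q0: (Q false); [right | left; rewrite -part0]; apply: eq_part => r /=;
    by case: (odd r); rewrite ?Qn Q0.
- by case=> ->; [exists pred0 | exists negb | exists id | exists predT].
case=> Q _ ->; case Q0: (Q false); case Q1: (Q true).
- by constructor 4; apply: eq_part => r /=; case: (odd r).
- by constructor 2; apply: eq_part => r /=; case: (odd r).
- by constructor 3; apply: eq_part => r /=; case: (odd r).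
by constructor 1; rewrite -part0; apply: eq_part => r /=; case: (odd r).
Qed.

(** * The two conditions as closure under cyclic generators *)

Section IntegralCayley.

Variables S S1 S2 : {set gT}.
Hypothesis S_eq : S = S1 :|: S2.
Hypothesis S1_sub : S1 \subset <[a]> :|: <[a]> :* b ^+ 2.
Hypothesis S2_sub : S2 \subset <[a]> :* b :|: <[a]> :* b ^+ 3.

Lemma mem_S1 r s :
  (a ^+ r * b ^+ s \in S1) = ~~ odd s && (a ^+ r * b ^+ s \in S).
Proof.
rewrite S_eq inE; have [s1 | s0] := boolP (odd s); last first.
  rewrite orb_idr // => /(subsetP S2_sub); rewrite inE.
  case/orP=> /rcosetP[_ /cycleP[i ->]] e; last by have := T8n_mod4 e; lia.
  by have := @T8n_mod4 _ _ _ 1 e; lia.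
apply/negbTE/negP=> /(subsetP S1_sub); rewrite inE.
case/orP=> [/cycleP[i] | /rcosetP[_ /cycleP[i ->]]] e.
  by rewrite -[a ^+ i]mulg1 in e; have := @T8n_mod4 _ _ _ 0 e; lia.
by have := T8n_mod4 e; lia.
Qed.

Lemma mem_S2 r s :
  (a ^+ r * b ^+ s \in S2) = odd s && (a ^+ r * b ^+ s \in S).
Proof.
have := mem_S1 r s; rewrite S_eq inE.
have [s1 -> //= | s0 _ /=] := boolP (odd s).
apply/negbTE/negP=> /(subsetP S2_sub); rewrite inE.
case/orP=> /rcosetP[_ /cycleP[i ->]] e; last by have := T8n_mod4 e; lia.
by have := @T8n_mod4 _ _ _ 1 e; lia.
Qed.

(** Each block consists of all generators of one cyclic group, so a closed [S1] is the union of the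
    blocks of its own elements. *)
Lemma S1_conditionP :
  S1_condition n a b S1 <->
  forall x y, <[x]> = <[y]> -> x \in S1 -> y \in S1.
Proof.
split=> [[R [Q ->]] x y exy | cl].
  case/setUP=> /bigcupP[r rR xr]; apply/setUP; [left|right]; apply/bigcupP;
    exists r => //; move: xr; rewrite ?bracket_aE ?bracket_ab2E !inE -exy; exact.
pose R : {set 'I_(2 * n)} := [set r | a ^+ val r \in S1].
pose Q : {set 'I_(2 * n)} := [set r | a ^+ val r * b ^+ 2 \in S1].
have ltm i : i %% (2 * n) < 2 * n by rewrite ltn_mod muln_gt0.
exists R, Q; apply/setP=> x; apply/idP/setUP=> [xS1 |].
  have := subsetP S1_sub _ xS1; rewrite inE.
  case/orP=> [/cycleP[i dx] | /rcosetP[_ /cycleP[i ->] dx]]; [left | right];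
    apply/bigcupP; exists (Ordinal (ltm i)).
  - by rewrite inE /= T8n_aX -dx.
  - by rewrite bracket_aE inE /= T8n_aX -dx.
  - by rewrite inE /= T8n_aX -dx.
  by rewrite bracket_ab2E inE /= T8n_aX -dx.
case=> /bigcupP[r]; rewrite ?bracket_aE ?bracket_ab2E !inE => Sr /eqP/esym ex;
  exact: cl ex Sr.
Qed.

Lemma S2_condition_cycleP : normal_Cay S ->
  S2_condition n a b S2 <->
  forall x y, <[x]> = <[y]> -> x \in S2 -> y \in S2.
Proof.
move=> nS; rewrite S2_conditionP; split=> [[Q Qn ->] x y exy Sx | cl].
  have [r [s [s1 dx]]] := odd_partP Sx.
  have /cycleP[m dy] : y \in <[x]> by rewrite exy cycle_id.
  have m1 : odd m.
    apply: (@T8n_coprime_order_odd r s); first by lia.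
    by rewrite -dx -generator_coprime /generator -dy exy.
  rewrite dy dx T8n_abX_odd // mem_odd_part ?oddM ?s1 //.
  by rewrite dx mem_odd_part in Sx.
have S2b r s : odd s -> (a ^+ r * b ^+ s \in S2) = (a ^+ r * b \in S2).
  have x8 m : odd m -> <[a ^+ r * b ^+ m]> = <[a ^+ r * b]>.
    move=> m1; have := @T8n_abX_odd r 1 m isT m1; rewrite mul1n expg1 => <-.
    apply/esym/eqP; rewrite -[_ == _]/(generator _ _) generator_coprime.
    apply: (@coprime_dvdl _ 8).
      rewrite order_dvdn; apply/eqP/(mulgI (a ^+ r * b)); rewrite -expgS mulg1.
      by rewrite -{1}[b]expg1 T8n_abX_odd // mul1n (expgD b 8 1) T8n_b8 mul1g.
    by apply: (@coprimeXl 3 2); rewrite coprime2n.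
  by move=> s1; apply/idP/idP; apply: cl; rewrite x8.
(* Conjugation by [a^-1] takes a^r b to a^(r+2) b. *)
have S2D2 r : (a ^+ r.+2 * b \in S2) = (a ^+ r * b \in S2).
  rewrite -[b]expg1 !mem_S2 ![odd 1]/= !andTb.
  rewrite -(@normal_Cay_memJ _ _ (a ^+ r * b ^+ 1) a^-1 nS).
  congr (_ \in S); rewrite conjgE invgK -[_ * a^-1]mulgA.
  rewrite T8n_bX_mul ?groupV ?cycle_id //.
  by rewrite [odd 1]/= invgK (expgS a r.+1) (expgSr a r) !mulgA.
have S2odd r : (a ^+ r * b \in S2) = (a ^+ odd r * b \in S2).
  rewrite -{1}(odd_double_half r).
  elim: (r./2) => [|k IHk]; first by rewrite addn0.
  by rewrite doubleS !addnS S2D2.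
pose Q (c : bool) := a ^+ c * b \in S2.
have Qn : odd n -> Q true = Q false.
  (* Here b^5 = a^n b links r = 0 with r = n, which is odd. *)
  move=> n1; rewrite /Q mul1g -{2}[b]mul1g -(S2b 0 5) // mul1g (expgD b 4 1).
  by rewrite T8n_b4 expg1 (S2odd n) n1.
exists Q => //; apply/setP=> x; have [r [s [_ _ ->]]] := T8n_normal_form x.
have [s1 | s0] := boolP (odd s); first by rewrite mem_odd_part // S2b // S2odd.
rewrite mem_S2 (negPf s0); apply/esym/negbTE/negP => /odd_partP[i [j [j1]]].
by move/T8n_mod4; lia.
Qed.

End IntegralCayley.

End T8nTheory.

Theorem theorem5p1 (gT : finGroupType) (n : nat) (a b : gT)
    (S S1 S2 : {set gT})
    (n_gt0 : 0 < n)
    (T8n : is_T8n n a b)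
    (S_neq0 : S != set0)
    (S_no1 : 1 \notin S)
    (S_inv : S = S^-1)
    (S_eq : S = S1 :|: S2)
    (S1_sub : S1 \subset <[a]> :|: <[a]> :* b ^+ 2)
    (S2_sub : S2 \subset <[a]> :* b :|: <[a]> :* b ^+ 3)
    (S_normal : normal_Cay S) :
  integral_graph (Cay S) <-> S1_condition n a b S1 /\ S2_condition n a b S2.
Proof.
rewrite (S1_conditionP n_gt0 T8n S1_sub).
rewrite (S2_condition_cycleP n_gt0 T8n S_eq S1_sub S2_sub S_normal).
rewrite integral_normal_Cay_cycleP //.
have mem1 := mem_S1 n_gt0 T8n S_eq S1_sub S2_sub.
have mem2 := mem_S2 n_gt0 T8n S_eq S1_sub S2_sub.
split=> [cl | [cl1 cl2] x y exy]; last first.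
  by rewrite S_eq !inE => /orP[/(cl1 _ _ exy)-> | /(cl2 _ _ exy)->] //; rewrite orbT.
have form := T8n_normal_form n_gt0 T8n.
split=> x y; have [[r [s [_ _ ->]]] [r' [s' [_ _ ->]]]] := (form x, form y);
  move=> exy; rewrite ?mem1 ?mem2 (T8n_cycle_parity n_gt0 T8n exy);
  by case/andP=> -> /(cl _ _ exy).
Qed.
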